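(* Let $0<\alpha\le 1$, $\beta>0$, let $(a,b)\subseteq(0,\infty)$ be an open interval, let $t_0\in(a,b)$ and $y_0\in\mathbb{R}$, and let $p,f:(a,b)\to\mathbb{R}$ be such that the functions $t\mapsto\Gamma(\beta+1)t^{\alpha-1}p(t)$ and $t\mapsto\Gamma(\beta+1)t^{\alpha-1}f(t)$ are continuous on $(a,b)$. Then the initial value problem $$D^{\alpha,\beta}_{M}y(t)+p(t)y(t)=f(t),\qquad y(t_0)=y_0,$$ has exactly one solution on $(a,b)$, i.e. there is exactly one $M$-differentiable function $y:(a,b)\to\mathbb{R}$ satisfying the equation for all $t\in(a,b)$ and the initial condition.
   Context: For $\beta>0$, $\mathbb{E}_\beta(z)=\sum_{k=0}^{\infty}\frac{z^k}{\Gamma(\beta k+1)}$ is the one-parameter Mittag-Leffler function. For $0<\alpha\le 1$, $\beta>0$, the $M$-fractional derivative of order $\alpha$ of a function $f$ at a point $t>0$ is $$D^{\alpha,\beta}_{M}f(t)=\lim_{\epsilon\to0}\frac{f\big(t\,\mathbb{E}_\beta(\epsilon t^{-\alpha})\big)-f(t)}{\epsilon},$$ and $f$ is called $M$-differentiable at $t$ if this limit exists (and $M$-differentiable on an interval if it is so at each of its points). *)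

(* Defs.v *)
From Stdlib Require Import Reals.
From Coquelicot Require Import Coquelicot.
Open Scope R_scope.

(** Euler's integral; the value is meaningful for [0 < x]. *)
Definition Gamma (x : R) : R :=
  RInt_gen (fun t => Rpower t (x - 1) * exp (- t))
           (at_right 0) (Rbar_locally p_infty).

Definition mittag_leffler (beta z : R) : R :=
  PSeries (fun k => / Gamma (beta * INR k + 1)) z.

Definition Mquotient (alpha beta : R) (f : R -> R) (t eps : R) : R :=
  (f (t * mittag_leffler beta (eps * Rpower t (- alpha))) - f t) / eps.

(** Relational, existential and total forms, as for Coquelicot's
    [is_derive], [ex_derive] and [Derive]; they are intended for [0 < t].
    The limit must be finite. *)
Definition is_Mderive (alpha beta : R) (f : R -> R) (t l : R) : Prop :=
  is_lim (Mquotient alpha beta f t) 0 l.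

Definition ex_Mderive (alpha beta : R) (f : R -> R) (t : R) : Prop :=
  exists l : R, is_Mderive alpha beta f t l.

Definition Mderive (alpha beta : R) (f : R -> R) (t : R) : R :=
  real (Lim (Mquotient alpha beta f t) 0).

Definition in_open (a b : Rbar) (t : R) : Prop := Rbar_lt a t /\ Rbar_lt t b.

(** Functions on [(a,b)] are represented by total functions [R -> R].  The
    notions below depend only on the values on [(a,b)]: the points
    [t * mittag_leffler beta (eps * Rpower t (- alpha))] tend to [t] as [eps]
    tends to [0], hence lie in [(a,b)] for small [eps]. *)
Definition is_Mivp_solution (alpha beta : R) (a b : Rbar) (p f : R -> R)
    (t0 y0 : R) (y : R -> R) : Prop :=
  (forall t : R, in_open a b t -> ex_Mderive alpha beta y t) /\
  (forall t : R, in_open a b t -> Mderive alpha beta y t + p t * y t = f t) /\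
  y t0 = y0.

(* Main.v *)
Require Import Defs.
From Stdlib Require Import Reals Lra.
From Coquelicot Require Import Coquelicot.
Open Scope R_scope.

(** The M-derivative is an ordinary derivative in disguise. The difference
    quotient defining it follows [f] along the curve
    [phi e = t * mittag_leffler beta (e * Rpower t (- alpha))], which passes
    through [t] at [e = 0] with velocity
    [c = t * Rpower t (- alpha) / Gamma (beta + 1) > 0].  If [f] is
    differentiable at [t], the chain rule gives the M-derivative [c * f'(t)].
    Conversely, as [phi] is continuous near 0 with nonzero velocity, it covers
    a neighbourhood of [t] at comparable speed, so a limit along [phi] is a
    genuine derivative
    (lemma [is_derive_of_quotient_along_curve]).  Hence [f] has M-derivative
    [l] at [t > 0] if and only if it has derivative
    [Gamma (beta + 1) * Rpower t (alpha - 1) * l] there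
    (lemma [is_Mderive_iff_is_derive]).

    The initial value problem therefore has the same solutions as the linear
    equation [y' = q - g y], whose coefficients
    [g = Gamma (beta + 1) * Rpower t (alpha - 1) * p] and
    [q = Gamma (beta + 1) * Rpower t (alpha - 1) * f] are the functions assumed
    continuous.  That equation is solved on the whole interval, uniquely, by
    the integrating factor [exp (A t)] with [A' = g]
    (lemma [linear_ivp_exists_unique]).

    The velocity of [phi] requires analytic facts about Euler's integral: it
    converges and is at least [exp (- 2)] on [1, +oo), so the Mittag-Leffler
    series has bounded coefficients and may be differentiated term by term in
    the unit disc; and [Gamma 1 = 1], so the series has value 1 at 0. *)

Lemma continuous_of_ex_derive (f : R -> R) (x : R) :
  ex_derive f x -> continuous f x.
Proof. exact (ex_derive_continuous f x). Qed.

(** * Improper integrals of nonnegative functions *)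

(** Integrals of a nonnegative function grow with the interval, so once one of
    them is within [eps] of the supremum, all larger ones are too. This treats
    the two improper endpoints simultaneously. *)
Lemma is_RInt_gen_nonneg_lub (f : R -> R) (L : R) :
  (forall t, 0 < t -> 0 <= f t) ->
  (forall t, 0 < t -> continuous f t) ->
  is_lub (fun x => exists u v, 0 < u <= v /\ x = RInt f u v) L ->
  is_RInt_gen f (at_right 0) (Rbar_locally p_infty) L.
Proof.
  intros Hpos Hcont [Hub Hleast].
  assert (Hint : forall u v, 0 < u -> 0 < v -> ex_RInt f u v).
  { intros u v Hu Hv. apply (ex_RInt_continuous f). intros z [Hz _].
    apply Hcont. apply Rlt_le_trans with (2 := Hz). now apply Rmin_glb_lt. }
  intros P [eps HP].
  assert (Hnear : exists u0 v0, 0 < u0 <= v0 /\ L - eps < RInt f u0 v0).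
  { apply Classical_Prop.NNPP. intros Hno.
    assert (L <= L - eps).
    { apply Hleast. intros x (u & v & Huv & ->). apply Rnot_lt_le. intros Hlt.
      apply Hno. now exists u, v. }
    destruct eps as [e He]; simpl in *; lra. }
  destruct Hnear as (u0 & v0 & Huv0 & Hlt).
  unfold filtermapi.
  apply (Filter_prod _ _ _ (fun u => 0 < u < u0) (fun v => v0 < v)).
  - exists (mkposreal u0 (proj1 Huv0)). intros y Hy Hy0.
    apply Rabs_lt_between in Hy. unfold minus, plus, opp in Hy; simpl in Hy. lra.
  - now exists v0.
  - intros u v Hu Hv. exists (RInt f u v). split.
    + apply (RInt_correct f). simpl. apply Hint; lra.
    + apply HP. apply Rabs_lt_between. unfold minus, plus, opp; simpl.
      assert (RInt f u v <= L) by (apply Hub; exists u, v; split; [lra|easy]).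
      assert (RInt f u v = RInt f u u0 + (RInt f u0 v0 + RInt f v0 v)) as E.
      { symmetry. etransitivity; [apply f_equal|];
          apply (RInt_Chasles f); apply Hint; lra. }
      assert (0 <= RInt f u u0).
      { apply RInt_ge_0; [lra | apply Hint; lra | intros; apply Hpos; lra]. }
      assert (0 <= RInt f v0 v).
      { apply RInt_ge_0; [lra | apply Hint; lra | intros; apply Hpos; lra]. }
      destruct eps as [e He]; simpl in *; lra.
Qed.

Lemma RInt_gen_ge_RInt (f : R -> R) (M u v : R) :
  (forall t, 0 < t -> 0 <= f t) ->
  (forall t, 0 < t -> continuous f t) ->
  (forall u v, 0 < u <= v -> RInt f u v <= M) ->
  0 < u <= v ->
  RInt f u v <= RInt_gen f (at_right 0) (Rbar_locally p_infty).
Proof.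
  intros Hpos Hcont HM Huv.
  destruct (completeness (fun x => exists u v, 0 < u <= v /\ x = RInt f u v))
    as [L HL].
  - exists M. intros x (u' & v' & Huv' & ->). now apply HM.
  - exists (RInt f u v). now exists u, v.
  - rewrite (is_RInt_gen_unique f L) by now apply is_RInt_gen_nonneg_lub.
    apply HL. now exists u, v.
Qed.

(** * Euler's integral on [1, +oo) *)

Lemma is_RInt_exp_scale (c k u v : R) :
  k <> 0 ->
  is_RInt (fun t => c * exp (k * t)) u v (c / k * (exp (k * v) - exp (k * u))).
Proof.
  intros Hk.
  replace (c / k * (exp (k * v) - exp (k * u)))
    with (minus (c / k * exp (k * v)) (c / k * exp (k * u)))
    by (unfold minus, plus, opp; simpl; ring).
  apply (is_RInt_derive (fun t => c / k * exp (k * t))).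
  - intros x _. auto_derive; [exact I|]. field. exact Hk.
  - intros x _. apply continuous_of_ex_derive.
    auto_derive. exact I.
Qed.

(** Puts half of the exponential decay aside to absorb the power. The scale
    [2 * (s + 1)] makes [ln w <= w], applied to [w = t / (2 * (s + 1))], give
    [s * ln w <= t / 2] including for [s = 0]. *)
Lemma Rpower_le_exp_half (s t : R) :
  0 <= s -> 0 < t ->
  Rpower t s <= exp (s * ln (2 * (s + 1))) * exp (t / 2).
Proof.
  intros Hs Ht. unfold Rpower. rewrite <- exp_plus.
  assert (Hle : forall x y, x <= y -> exp x <= exp y).
  { intros x y [H| ->]; [left; now apply exp_increasing | right; easy]. }
  apply Hle.
  set (w := t / (2 * (s + 1))).
  assert (Hw : 0 < w) by (apply Rdiv_lt_0_compat; lra).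
  assert (Hlnw : ln w <= w).
  { pose proof (exp_ineq1_le (ln w)) as H. rewrite exp_ln in H by easy. lra. }
  assert (Et : t = w * (2 * (s + 1))) by (unfold w; field; lra).
  assert (Eln : ln t = ln w + ln (2 * (s + 1))).
  { rewrite Et at 1. apply ln_mult; lra. }
  rewrite Eln.
  assert (s * ln w <= s * w) by now apply Rmult_le_compat_l.
  assert (s * w <= t / 2) by (rewrite Et; nra).
  lra.
Qed.

Lemma Gamma_integrand_continuous (x t : R) :
  0 < t -> continuous (fun t => Rpower t (x - 1) * exp (- t)) t.
Proof.
  intros Ht. unfold Rpower.
  apply continuous_of_ex_derive. auto_derive. exact Ht.
Qed.

(** On [1, 2] the integrand is at least [exp (- 2)] as soon as the exponent
    [x - 1] is nonnegative. A crude bound uniform in [x] is all that the radius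
    of convergence below asks for; the integral itself must be shown to
    converge, since otherwise [RInt_gen] has no relation to the integrand. *)
Lemma Gamma_lower_bound (x : R) : 1 <= x -> exp (- 2) <= Gamma x.
Proof.
  intros Hx.
  set (g := fun t => Rpower t (x - 1) * exp (- t)).
  set (C := exp ((x - 1) * ln (2 * (x - 1 + 1)))).
  assert (Hex : forall u v, 0 < u <= v -> ex_RInt g u v).
  { intros u v Huv. apply (ex_RInt_continuous g). intros z [Hz _].
    apply Gamma_integrand_continuous. rewrite Rmin_left in Hz; lra. }
  apply Rle_trans with (RInt g 1 2).
  - replace (exp (- 2)) with (RInt (fun _ => exp (- 2)) 1 2)
      by (rewrite RInt_const; unfold scal; simpl; unfold mult; simpl; ring).
    apply RInt_le.
    + lra.
    + apply ex_RInt_const.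
    + apply Hex; lra.
    + intros t Ht. unfold g.
      assert (1 <= Rpower t (x - 1)).
      { rewrite <- (Rpower_O t) at 1 by lra. apply Rle_Rpower; lra. }
      assert (exp (- 2) < exp (- t)) by (apply exp_increasing; lra).
      pose proof (exp_pos (- t)). nra.
  - apply (RInt_gen_ge_RInt g (2 * C)); [| | | lra].
    + intros t Ht. unfold g, Rpower. left.
      apply Rmult_lt_0_compat; apply exp_pos.
    + intros t Ht. now apply Gamma_integrand_continuous.
    + intros u v Huv.
      assert (HI := is_RInt_exp_scale C (- / 2) u v ltac:(lra)).
      apply Rle_trans with (RInt (fun t => C * exp (- / 2 * t)) u v).
      * apply RInt_le; [lra | now apply Hex | eexists; exact HI |].
        intros t Ht. unfold g.
        replace (exp (- / 2 * t)) with (exp (t / 2) * exp (- t))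
          by (rewrite <- exp_plus; f_equal; field).
        rewrite <- Rmult_assoc. apply Rmult_le_compat_r; [left; apply exp_pos|].
        apply Rpower_le_exp_half; lra.
      * rewrite (is_RInt_unique _ _ _ _ HI).
        pose proof (exp_pos (- / 2 * v)).
        assert (exp (- / 2 * u) < 1)
          by (rewrite <- exp_0; apply exp_increasing; lra).
        assert (0 < C) by apply exp_pos.
        replace (C / - / 2) with (- 2 * C) by field. nra.
Qed.

Lemma Gamma_1 : Gamma 1 = 1.
Proof.
  apply is_RInt_gen_unique.
  set (F := fun t => - exp (- t)).
  assert (HD : forall t, is_derive F t (exp (- t))).
  { intros t. unfold F. auto_derive; [exact I | ring]. }
  apply (is_RInt_gen_ext (Derive F)).
  - apply (Filter_prod _ _ _ (fun u => 0 < u) (fun v => 0 < v)).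
    + exists (mkposreal 1 Rlt_0_1). now intros.
    + now exists 0.
    + simpl. intros u v Hu Hv t Ht. rewrite (is_derive_unique _ _ _ (HD t)).
      replace (1 - 1) with 0 by ring. rewrite Rpower_O; [ring|].
      apply Rlt_trans with (2 := proj1 Ht). now apply Rmin_glb_lt.
  - replace 1 with (0 - F 0) by (unfold F; rewrite Ropp_0, exp_0; ring).
    apply is_RInt_gen_Derive.
    + apply filter_forall. intros uv x _. eexists. apply HD.
    + apply filter_forall. intros uv x _.
      apply (continuous_ext (fun t => exp (- t))).
      * intros t. symmetry. apply is_derive_unique, HD.
      * apply continuous_of_ex_derive. auto_derive. exact I.
    + apply (filterlim_filter_le_1 F (filter_le_within (F:=locally 0) _)).
      apply continuous_of_ex_derive. eexists. apply HD.
    + change (is_lim F p_infty 0). unfold F. rewrite <- Ropp_0.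
      apply (is_lim_opp _ _ 0).
      apply (is_lim_comp exp Ropp p_infty 0 m_infty).
      * apply is_lim_exp_m.
      * apply (is_lim_opp _ _ p_infty), is_lim_id.
      * now apply filter_forall.
Qed.

(** * The Mittag-Leffler function near 0 *)

(** The true radius is infinite; radius 1 already makes the function
    differentiable at 0 and continuous around it. *)
Lemma CV_radius_mittag_leffler (beta : R) :
  0 < beta ->
  Rbar_le 1 (CV_radius (fun k => / Gamma (beta * INR k + 1))).
Proof.
  intros Hb. apply (proj1 (CV_radius_bounded _)).
  exists (exp 2). intros n.
  rewrite pow1, Rmult_1_r.
  assert (HG : exp (- 2) <= Gamma (beta * INR n + 1)).
  { apply Gamma_lower_bound. pose proof (pos_INR n). nra. }
  pose proof (exp_pos (- 2)).
  rewrite Rabs_pos_eq by (left; apply Rinv_0_lt_compat; lra).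
  replace 2 with (- - 2) at 1 by ring. rewrite (exp_Ropp (- 2)).
  apply Rinv_le_contravar; lra.
Qed.

Lemma mittag_leffler_0 (beta : R) : mittag_leffler beta 0 = 1.
Proof.
  unfold mittag_leffler. rewrite PSeries_0. simpl.
  rewrite Rmult_0_r, Rplus_0_l, Gamma_1. apply Rinv_1.
Qed.

Lemma ex_derive_mittag_leffler (beta z : R) :
  0 < beta -> Rabs z < 1 -> ex_derive (mittag_leffler beta) z.
Proof.
  intros Hb Hz. apply ex_derive_PSeries.
  eapply Rbar_lt_le_trans; [|now apply CV_radius_mittag_leffler]. exact Hz.
Qed.

Lemma is_derive_mittag_leffler_0 (beta : R) :
  0 < beta -> is_derive (mittag_leffler beta) 0 (/ Gamma (beta + 1)).
Proof.
  intros Hb.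
  evar_last.
  - apply is_derive_PSeries.
    eapply Rbar_lt_le_trans; [|now apply CV_radius_mittag_leffler].
    simpl. rewrite Rabs_R0. exact Rlt_0_1.
  - rewrite PSeries_0. unfold PS_derive. simpl. now rewrite Rmult_1_r, Rmult_1_l.
Qed.

(** * Difference quotients along a curve *)

Lemma is_derive_is_lim (f : R -> R) (x l : R) :
  is_derive f x l <-> is_lim (fun h => (f (x + h) - f x) / h) 0 l.
Proof.
  rewrite is_derive_Reals, <- is_lim_spec. split.
  - intros H eps. destruct (H eps (cond_pos eps)) as [d Hd].
    exists d. intros h Hh Hh0. apply Hd; [exact Hh0|].
    rewrite <- (Rminus_0_r h). exact Hh.
  - intros H eps Heps. destruct (H (mkposreal eps Heps)) as [d Hd].
    exists d. intros h Hh0 Hh. apply (Hd h); [|exact Hh0].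
    change (Rabs (h - 0) < d). now rewrite Rminus_0_r.
Qed.

Lemma is_lim_curve_slope (phi : R -> R) (t c : R) :
  phi 0 = t -> is_derive phi 0 c -> is_lim (fun e => (phi e - t) / e) 0 c.
Proof.
  intros phi_0 phi_derive.
  apply (is_lim_ext (fun h => (phi (0 + h) - phi 0) / h)).
  - intros h. now rewrite Rplus_0_l, phi_0.
  - now apply is_derive_is_lim.
Qed.

Lemma is_lim_quotient_along_curve
    (phi : R -> R) (t c : R) (f : R -> R) (m : R) :
  phi 0 = t -> is_derive phi 0 c -> is_derive f t m ->
  is_lim (fun e => (f (phi e) - f t) / e) 0 (c * m).
Proof.
  intros phi_0 phi_derive Hf.
  apply (is_lim_ext (fun h => (f (phi (0 + h)) - f (phi 0)) / h)).
  - intros h. now rewrite Rplus_0_l, phi_0.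
  - apply (is_derive_is_lim (fun e => f (phi e))).
    apply (is_derive_comp f phi); [now rewrite phi_0 | exact phi_derive].
Qed.

(** A continuous function with positive slope at 0 takes values on both sides
    of [phi 0] arbitrarily close to 0, so the intermediate value theorem
    produces the values in between; the bound [c / 2 * r] on [k] comes from
    the difference quotient exceeding [c / 2] at [r] and at [- r]. *)
Lemma curve_locally_onto (phi : R -> R) (t c d : R) :
  phi 0 = t -> 0 < c -> is_derive phi 0 c ->
  locally 0 (fun e => continuity_pt phi e) ->
  0 < d ->
  exists eta, 0 < eta /\
    forall k, Rabs k < eta -> exists e, Rabs e < d /\ phi e = t + k.
Proof.
  intros phi_0 c_pos phi_derive [d1 H1] Hd.
  pose proof (is_lim_curve_slope phi t c phi_0 phi_derive) as phi_slope.
  apply is_lim_spec in phi_slope.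
  destruct (phi_slope (mkposreal (c / 2) ltac:(simpl; lra))) as [d2 H2].
  simpl in H2.
  set (r := Rmin d (Rmin d1 d2) / 2).
  assert (Hr : 0 < r /\ r < d /\ r < d1 /\ r < d2).
  { assert (0 < Rmin d (Rmin d1 d2))
      by (repeat apply Rmin_glb_lt; [exact Hd | apply cond_pos..]).
    pose proof (Rmin_l d (Rmin d1 d2)). pose proof (Rmin_r d (Rmin d1 d2)).
    pose proof (Rmin_l d1 d2). pose proof (Rmin_r d1 d2).
    unfold r. lra. }
  assert (Hs : forall e, Rabs e = r -> c / 2 < (phi e - t) / e).
  { intros e He. assert (Hlt : Rabs ((phi e - t) / e - c) < c / 2).
    { apply H2.
      - change (Rabs (e - 0) < d2). rewrite Rminus_0_r. lra.
      - intros ->. rewrite Rabs_R0 in He. lra. }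
    apply Rabs_lt_between in Hlt. lra. }
  exists (c / 2 * r). split; [apply Rmult_lt_0_compat; lra|].
  intros k Hk. apply Rabs_lt_between in Hk.
  assert (Hright : k < phi r - t).
  { assert (H := Hs r (Rabs_pos_eq r ltac:(lra))).
    apply (Rmult_lt_compat_r r) in H; [|lra].
    replace ((phi r - t) / r * r) with (phi r - t) in H by (field; lra). lra. }
  assert (Hleft : phi (- r) - t < k).
  { assert (H := Hs (- r)). rewrite Rabs_Ropp in H.
    specialize (H (Rabs_pos_eq r ltac:(lra))).
    apply (Rmult_lt_compat_r r) in H; [|lra].
    replace ((phi (- r) - t) / - r * r) with (- (phi (- r) - t)) in H
      by (field; lra). lra. }
  destruct (Ranalysis5.IVT_interv (fun e => phi e - (t + k)) (- r) r)
    as [e [He Hphi]].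
  - intros e He. apply continuity_pt_minus.
    + apply H1. change (Rabs (e - 0) < d1). rewrite Rminus_0_r.
      apply Rabs_lt_between. lra.
    + apply continuity_pt_const. now intros x y.
  - lra.
  - lra.
  - lra.
  - exists e. split; [apply Rabs_lt_between|]; lra.
Qed.

(** The converse of the chain rule along a curve. The quotient of [f] along
    [phi] divided by the slope of [phi] is the increment ratio of [f] between
    [t] and [phi e], and every small increment [k] of [t] is of the form
    [phi e - t] with [e] small. *)
Lemma is_derive_of_quotient_along_curve
    (phi : R -> R) (t c : R) (f : R -> R) (l : R) :
  phi 0 = t -> 0 < c -> is_derive phi 0 c ->
  locally 0 (fun e => continuity_pt phi e) ->
  is_lim (fun e => (f (phi e) - f t) / e) 0 l -> is_derive f t (l / c).
Proof.
  intros phi_0 c_pos phi_derive phi_continuous Hf.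
  assert (Hdiv := is_lim_div _ _ 0 l c Hf
    (is_lim_curve_slope phi t c phi_0 phi_derive)
    (fun H => Rgt_not_eq _ _ c_pos (f_equal real H)) I).
  apply is_lim_spec in Hdiv.
  apply is_derive_Reals. intros eps Heps.
  destruct (Hdiv (mkposreal eps Heps)) as [d Hd]. simpl in Hd.
  destruct (curve_locally_onto phi t c d phi_0 c_pos phi_derive
    phi_continuous (cond_pos d)) as (eta & Heta & Honto).
  exists (mkposreal eta Heta). intros k Hk0 Hk.
  destruct (Honto k Hk) as (e & He & Hphi).
  assert (He0 : e <> 0) by (intros ->; apply Hk0; lra).
  rewrite <- Hphi.
  replace ((f (phi e) - f t) / k)
    with ((f (phi e) - f t) / e / ((phi e - t) / e)).
  - apply Hd; [|exact He0]. change (Rabs (e - 0) < d). now rewrite Rminus_0_r.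
  - rewrite Hphi. field. repeat split; lra.
Qed.

(** * M-derivatives as ordinary derivatives *)

(** The curve followed by the M-derivative at [t] has velocity [c] with
    [/ c = Gamma (beta + 1) * Rpower t (alpha - 1)]. *)
Lemma is_Mderive_iff_is_derive (alpha beta : R) (f : R -> R) (t l : R) :
  0 < beta -> 0 < t ->
  is_Mderive alpha beta f t l <->
  is_derive f t (Gamma (beta + 1) * Rpower t (alpha - 1) * l).
Proof.
  intros Hb Ht.
  set (phi := fun e => t * mittag_leffler beta (e * Rpower t (- alpha))).
  set (c := t * (Rpower t (- alpha) * / Gamma (beta + 1))).
  assert (HG : 0 < Gamma (beta + 1)).
  { apply Rlt_le_trans with (1 := exp_pos (- 2)).
    apply Gamma_lower_bound. lra. }
  assert (Hw : 0 < Rpower t (- alpha)) by apply exp_pos.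
  assert (Hphi0 : phi 0 = t).
  { unfold phi. rewrite Rmult_0_l, mittag_leffler_0. ring. }
  assert (Hc : 0 < c).
  { apply Rmult_lt_0_compat; [exact Ht|].
    apply Rmult_lt_0_compat; [exact Hw | now apply Rinv_0_lt_compat]. }
  assert (Hcinv : Gamma (beta + 1) * Rpower t (alpha - 1) = / c).
  { assert (E : Rpower t (alpha - 1) * Rpower t (- alpha) * t = 1).
    { rewrite <- (Rpower_1 t) at 3 by easy. rewrite <- !Rpower_plus.
      replace (alpha - 1 + - alpha + 1) with 0 by ring. now apply Rpower_O. }
    apply (Rmult_eq_reg_r c); [|lra]. rewrite Rinv_l by lra.
    unfold c.
    transitivity (Rpower t (alpha - 1) * Rpower t (- alpha) * t); [|exact E].
    field. lra. }
  assert (Hdphi : is_derive phi 0 c).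
  { unfold phi, c. apply (is_derive_scal (fun e => _)).
    apply (is_derive_comp (mittag_leffler beta)).
    - rewrite Rmult_0_l. now apply is_derive_mittag_leffler_0.
    - auto_derive; [exact I | ring]. }
  assert (Hcont : locally 0 (fun e => continuity_pt phi e)).
  { (* the argument of the Mittag-Leffler function stays in the unit disc *)
    exists (mkposreal _ (Rinv_0_lt_compat _ Hw)). intros e He.
    change (Rabs (e - 0) < / Rpower t (- alpha)) in He.
    rewrite Rminus_0_r in He.
    apply continuity_pt_filterlim, (continuous_of_ex_derive phi).
    unfold phi. apply (ex_derive_scal (fun e => _)).
    apply (ex_derive_comp (mittag_leffler beta)).
    - apply ex_derive_mittag_leffler; [exact Hb|].
      rewrite Rabs_mult, (Rabs_pos_eq (Rpower _ _)) by lra.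
      apply (Rmult_lt_compat_r _ _ _ Hw) in He.
      now rewrite Rinv_l in He by lra.
    - auto_derive. exact I. }
  rewrite Hcinv. split; intros H.
  - rewrite Rmult_comm.
    now apply (is_derive_of_quotient_along_curve phi t c).
  - apply (is_lim_quotient_along_curve phi t c f _ Hphi0 Hdphi) in H.
    rewrite <- Rmult_assoc, Rinv_r, Rmult_1_l in H by lra. exact H.
Qed.

(** * Linear differential equations on an open interval *)

Lemma in_open_between (a b : Rbar) (u v x : R) :
  in_open a b u -> in_open a b v -> Rmin u v <= x <= Rmax u v -> in_open a b x.
Proof.
  intros [Hau Hub] [Hav Hvb] [Hmin Hmax]. split.
  - apply Rbar_lt_le_trans with (2 := Hmin : Rbar_le (Rmin u v) x).
    now destruct (Rmin_case u v (fun w => w = u \/ w = v) (or_introl eq_refl)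
      (or_intror eq_refl)) as [-> | ->].
  - apply Rbar_le_lt_trans with (1 := Hmax : Rbar_le x (Rmax u v)).
    now destruct (Rmax_case u v (fun w => w = u \/ w = v) (or_introl eq_refl)
      (or_intror eq_refl)) as [-> | ->].
Qed.

Lemma antiderivative_in_open (a b : Rbar) (g : R -> R) (t0 : R) :
  in_open a b t0 ->
  (forall s, in_open a b s -> continuous g s) ->
  exists A : R -> R,
    A t0 = 0 /\ forall t, in_open a b t -> is_derive A t (g t).
Proof.
  intros Ht0 Hg. exists (RInt g t0). split; [apply (RInt_point t0 g)|].
  intros t Ht. apply (is_derive_RInt g _ t0); [|now apply Hg].
  apply (locally_interval _ t a b (proj1 Ht) (proj2 Ht)).
  intros s Has Hsb. apply (RInt_correct g), (ex_RInt_continuous g).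
  intros x Hx. apply Hg. now apply (in_open_between a b t0 s).
Qed.

Lemma is_derive_0_const_in_open (a b : Rbar) (w : R -> R) :
  (forall s, in_open a b s -> is_derive w s 0) ->
  forall u v, in_open a b u -> in_open a b v -> w u = w v.
Proof.
  intros Hw.
  assert (Hlt : forall u v, in_open a b u -> in_open a b v -> u < v -> w u = w v).
  { intros u v Hu Hv Huv. apply (eq_is_derive w); [|exact Huv].
    intros s Hs. apply Hw. apply (in_open_between a b u v); try easy.
    rewrite Rmin_left, Rmax_right; lra. }
  intros u v Hu Hv. destruct (Rtotal_order u v) as [H|[->|H]].
  - now apply Hlt.
  - reflexivity.
  - symmetry. now apply Hlt.
Qed.

(** With [A' = g] and [A t0 = 0], multiplying the equation by [exp (A t)] turns
    it into [(exp (A t) * y)' = exp (A t) * q t], which is integrated from [t0].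
    For two solutions the product of [exp (A t)] with their difference has
    derivative zero. *)
Lemma linear_ivp_exists_unique (a b : Rbar) (g q : R -> R) (t0 y0 : R) :
  in_open a b t0 ->
  (forall s, in_open a b s -> continuous g s) ->
  (forall s, in_open a b s -> continuous q s) ->
  exists y : R -> R,
    (forall t, in_open a b t -> is_derive y t (q t - g t * y t)) /\
    y t0 = y0 /\
    forall z : R -> R,
      (forall t, in_open a b t -> is_derive z t (q t - g t * z t)) ->
      z t0 = y0 ->
      forall t, in_open a b t -> z t = y t.
Proof.
  intros Ht0 Hg Hq.
  destruct (antiderivative_in_open a b g t0 Ht0 Hg) as (A & HA0 & HA).
  destruct (antiderivative_in_open a b (fun s => exp (A s) * q s) t0 Ht0)
    as (B & HB0 & HB).
  { intros s Hs. apply (continuous_mult (fun s => exp (A s)) q); [|now apply Hq].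
    apply continuous_of_ex_derive, (ex_derive_comp exp A).
    - auto_derive. exact I.
    - eexists. now apply HA. }
  assert (exists y : R -> R, y t0 = y0 /\
    forall t, in_open a b t -> is_derive y t (q t - g t * y t))
    as (y & Hy0 & Hy).
  { exists (fun t => exp (- A t) * (y0 + B t)). split.
    - rewrite HA0, HB0, Ropp_0, exp_0. ring.
    - intros t Ht. specialize (HA t Ht). specialize (HB t Ht).
      auto_derive.
      + split; [eexists; exact HA | split; [eexists; exact HB | exact I]].
      + rewrite (is_derive_unique (fun x : R => A x) _ _ HA).
        rewrite (is_derive_unique (fun x : R => B x) _ _ HB).
        rewrite exp_Ropp. field. apply Rgt_not_eq, exp_pos. }
  exists y. split; [exact Hy|]. split; [exact Hy0|].
  intros z Hz Hz0 t Ht.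
  assert (Hw : exp (A t) * (z t - y t) = exp (A t0) * (z t0 - y t0)).
  { apply (is_derive_0_const_in_open a b (fun s => exp (A s) * (z s - y s)));
      try easy.
    intros s Hs. specialize (HA s Hs). specialize (Hy s Hs). specialize (Hz s Hs).
    auto_derive.
    - repeat split; eexists; eassumption.
    - rewrite (is_derive_unique (fun x : R => A x) _ _ HA).
      rewrite (is_derive_unique (fun x : R => y x) _ _ Hy).
      rewrite (is_derive_unique (fun x : R => z x) _ _ Hz). ring. }
  rewrite Hz0, Hy0, Rminus_diag, Rmult_0_r in Hw.
  apply Rmult_integral in Hw. pose proof (exp_pos (A t)). lra.
Qed.

(** * The initial value problem *)

Lemma Mequation_iff_linear_ode (alpha beta : R) (y : R -> R) (t r s : R) :
  0 < beta -> 0 < t ->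
  (ex_Mderive alpha beta y t /\ Mderive alpha beta y t + r * y t = s) <->
  is_derive y t
    (Gamma (beta + 1) * Rpower t (alpha - 1) * s
     - Gamma (beta + 1) * Rpower t (alpha - 1) * r * y t).
Proof.
  intros Hb Ht.
  replace (_ - _) with (Gamma (beta + 1) * Rpower t (alpha - 1) * (s - r * y t))
    by ring.
  rewrite <- is_Mderive_iff_is_derive by easy. split.
  - intros [[l Hl] Heq]. unfold Mderive in Heq.
    rewrite (is_lim_unique _ _ _ Hl) in Heq. simpl in Heq.
    now replace (s - r * y t) with l by lra.
  - intros Hl. split; [now exists (s - r * y t)|].
    unfold Mderive. rewrite (is_lim_unique _ _ _ Hl). simpl. ring.
Qed.

Theorem theorem3p1 :
  forall (alpha beta : R) (a b : Rbar) (t0 y0 : R) (p f : R -> R),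
  0 < alpha <= 1 ->
  0 < beta ->
  Rbar_le 0 a ->
  in_open a b t0 ->
  (forall t : R, in_open a b t ->
     continuous (fun s : R => Gamma (beta + 1) * Rpower s (alpha - 1) * p s) t) ->
  (forall t : R, in_open a b t ->
     continuous (fun s : R => Gamma (beta + 1) * Rpower s (alpha - 1) * f s) t) ->
  exists y : R -> R,
    is_Mivp_solution alpha beta a b p f t0 y0 y /\
    (forall z : R -> R,
       is_Mivp_solution alpha beta a b p f t0 y0 z ->
       forall t : R, in_open a b t -> z t = y t).
Proof.
  intros alpha beta a b t0 y0 p f _ Hb Ha Ht0 Hp Hf.
  assert (Hpos : forall t, in_open a b t -> 0 < t).
  { intros t [Hat _]. exact (Rbar_le_lt_trans 0 a t Ha Hat). }
  destruct (linear_ivp_exists_unique a b _ _ t0 y0 Ht0 Hp Hf)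
    as (y & Hy & Hy0 & Huniq).
  exists y. split.
  - split; [|split]; [| |exact Hy0]; intros t Ht;
      apply (Mequation_iff_linear_ode alpha beta y t (p t) (f t)); auto.
  - intros z (Hex & Heq & Hz0). apply Huniq; [|exact Hz0].
    intros t Ht. apply Mequation_iff_linear_ode; auto.
Qed.
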